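(* Assume $\theta=0$ and let $0\le n\le N-1$. Suppose the holding costs are functions of $\sigma$, $h_{t_i}=h_{t_i}(\sigma)$, that are linear in $\sigma$ for $n\le i\le N-1$, i.e. $h_{t_i}(C\sigma_0)=C\,h_{t_i}(\sigma_0)$ for all $C,\sigma_0>0$. Then the threshold $b(t_n)$ is linear in $\sigma$: for all $C,\sigma_0>0$, $$b(t_n;\sigma=C\sigma_0)=C\cdot b(t_n;\sigma=\sigma_0),$$ where $b(t_n;\sigma=s)$ denotes the threshold at time $t_n$ in the purchasing problem described in the context when the volatility is $\sigma=s$ and the holding costs are $h_{t_i}(s)$, all other parameters being kept the same.
   Context: Model. A single item must be purchased within a finite horizon $[0,T]$. Decisions are made on the grid $t_n = n\cdot dt$, $0\le n\le N$, with $dt>0$ and $N=T/dt$. The item's price follows the AR(1) process $X_t = \theta K\,dt + (1-K\,dt)X_{t-dt} + \sigma\varepsilon_t$, where $\theta\in\mathbb{R}$, $\sigma>0$, $|1-K\,dt|<1$, and the $\varepsilon_{t_1},\varepsilon_{t_2},\dots$ are i.i.d. $N(0,dt)$. For $t_n<t_i$, $X_{t_n,t_i}(x)$ denotes the random price $X_{t_i}$ conditioned on $X_{t_n}=x$. Holding the item from $t_n$ to $t_N$ costs $dt\sum_{i=n}^{N-1}h_{t_i}$, where the per-unit-time holding costs $h_{t_0},\dots,h_{t_{N-1}}$ are real numbers that are weakly decreasing in time. Value function. $V(x,t_N)=x$ (the item must be bought at $t_N$ if not bought before), and for $0\le n<N$, $$V(x,t_n)=\min\Big\{V^C(x,t_n),\;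 x+dt\sum_{i=n}^{N-1}h_{t_i}\Big\},\qquad V^C(x,t_n)=E\big[V(X_{t_n,t_{n+1}}(x),t_{n+1})\big].$$ Threshold. For $0\le n\le N-1$, $b(t_n)$ is the (single) real number with $V^C(b(t_n),t_n)=b(t_n)+dt\sum_{i=n}^{N-1}h_{t_i}$; by convention $b(t_N)=\infty$. *)

(* Defs.v *)
From HB Require Import structures.
From mathcomp Require Import all_boot all_order all_algebra.
From mathcomp Require Import all_classical all_reals all_analysis.
Import Order.TTheory GRing.Theory Num.Theory.
Import numFieldNormedType.Exports.

Set Implicit Arguments.
Unset Strict Implicit.
Unset Printing Implicit Defensive.

Local Open Scope classical_set_scope.
Local Open Scope ring_scope.

Definition mutually_independent (d : measure_display) (Om : measurableType d)
    (R : realType) (P : probability Om R) (I : set nat)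
    (X : nat -> {RV P >-> R}) : Prop :=
  forall (J : seq nat) (A : nat -> set R),
    uniq J -> [set` J] `<=` I -> (forall i, measurable (A i)) ->
    P (\bigcap_(i in [set` J]) (X i @^-1` A i)) =
    (\prod_(i <- J) P (X i @^-1` A i))%E.

(* [normal_prob m s] takes the standard deviation [s], so N(0, dt) is
   [normal_prob 0 (Num.sqrt dt)]. [eps i] is the shock at time i * dt; [eps 0]
   plays no role. *)
Definition iid_shocks (d : measure_display) (Om : measurableType d)
    (R : realType) (P : probability Om R) (dt : R) (N : nat)
    (eps : nat -> {RV P >-> R}) : Prop :=
  mutually_independent [set i | (0 < i <= N)%N] eps /\
  forall i, (0 < i <= N)%N ->
    forall A, measurable A ->
      distribution P (eps i) A = normal_prob 0 (Num.sqrt dt) A.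

(* Dates are represented by their index on the grid: n stands for n * dt. *)

(* The price at date n.+1 given the price x at date n. As eps n.+1 is
   independent of eps 1, ..., eps n, conditioning on the price at date n amounts
   to substituting x for it in the recursion. *)
Definition next_price (Om : Type) (R : realType) (theta K dt sigma : R)
    (eps : nat -> Om -> R) (n : nat) (x : R) : Om -> R :=
  fun w => theta * K * dt + (1 - K * dt) * x + sigma * eps n.+1 w.

(* Holding costs from date n to the horizon N. *)
Definition holding_cost (R : realType) (dt : R) (N : nat) (h : nat -> R)
    (n : nat) : R :=
  dt * \sum_(n <= i < N) h i.

(* Backward induction on the number m of remaining periods, the current date
   being N - m. *)
Fixpoint value_to_go (d : measure_display) (Om : measurableType d)
    (R : realType) (P : probability Om R) (eps : nat -> {RV P >-> R})
    (theta K dt : R) (N : nat) (sigma : R) (h : nat -> R) (m : nat) (x : R)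
    {struct m} : R :=
  if m is m'.+1 then
    Num.min
      (fine 'E_P[fun w => value_to_go eps theta K dt N sigma h m'
                   (next_price theta K dt sigma eps (N - m) x w)])
      (x + holding_cost dt N h (N - m))
  else x.

(* The value function V(x, t_n), for n <= N. *)
Definition value (d : measure_display) (Om : measurableType d)
    (R : realType) (P : probability Om R) (eps : nat -> {RV P >-> R})
    (theta K dt : R) (N : nat) (sigma : R) (h : nat -> R) (n : nat) (x : R) : R :=
  value_to_go eps theta K dt N sigma h (N - n) x.

(* The continuation value V^C(x, t_n), for n < N. The value function is
   1-Lipschitz when |1 - K dt| < 1, so that the expectation is finite. *)
Definition continuation_value (d : measure_display) (Om : measurableType d)
    (R : realType) (P : probability Om R) (eps : nat -> {RV P >-> R})
    (theta K dt : R) (N : nat) (sigma : R) (h : nat -> R) (n : nat) (x : R) : R :=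
  fine 'E_P[fun w => value eps theta K dt N sigma h n.+1
               (next_price theta K dt sigma eps n x w)].

Lemma value_horizon (d : measure_display) (Om : measurableType d)
    (R : realType) (P : probability Om R) (eps : nat -> {RV P >-> R})
    (theta K dt : R) (N : nat) (sigma : R) (h : nat -> R) (x : R) :
  value eps theta K dt N sigma h N x = x.
Proof. by rewrite /value subnn. Qed.

Lemma value_before_horizon (d : measure_display) (Om : measurableType d)
    (R : realType) (P : probability Om R) (eps : nat -> {RV P >-> R})
    (theta K dt : R) (N : nat) (sigma : R) (h : nat -> R) (n : nat) (x : R) :
  (n < N)%N ->
  value eps theta K dt N sigma h n x =
  Num.min (continuation_value eps theta K dt N sigma h n x)
          (x + holding_cost dt N h n).
Proof.
move=> nN; rewrite /continuation_value /value -(subnSK nN) /=.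
by rewrite (subnSK nN) (subKn (ltnW nN)).
Qed.

(* The threshold b(t_n), for n < N: the unique b with
   V^C(b, t_n) = b + holding cost. Existence and uniqueness hold because
   x |-> V^C(x, t_n) is |1 - K dt|-Lipschitz with |1 - K dt| < 1. *)
Definition threshold (d : measure_display) (Om : measurableType d)
    (R : realType) (P : probability Om R) (eps : nat -> {RV P >-> R})
    (theta K dt : R) (N : nat) (sigma : R) (h : nat -> R) (n : nat) : R :=
  get [set b : R | continuation_value eps theta K dt N sigma h n b =
                   b + holding_cost dt N h n].

(* Main.v *)
(** Multiplying the price, the volatility and the holding
    costs by [C > 0] multiplies the price recursion (as [theta = 0]) and both
    arguments of the minimum by [C]; backward induction gives
    [V(C x; C sigma) = C V(x; sigma)]. So [b] solves the threshold equation for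
    [sigma] iff [C b] solves it for [C sigma], and the solution is unique because
    the continuation value is a [|1 - K dt|]-contraction. Taking constants out
    of expectations needs integrability: the value function is 1-Lipschitz and
    a normal variable is integrable. *)

Require Import Defs.
From HB Require Import structures.
From mathcomp Require Import all_boot all_order all_algebra.
From mathcomp Require Import all_classical all_reals all_analysis.
From mathcomp Require Import measurable_realfun ring lra.
Import Order.TTheory GRing.Theory Num.Theory.
Import numFieldNormedType.Exports.

Local Open Scope classical_set_scope.
Local Open Scope ring_scope.

(** * First moment of the normal distribution *)

(** Doubling the standard deviation leaves a spare factor [expR t] with t = 3 x^2 / (8 s^2); being
    at least 1 + t, it absorbs [|x|]. *)
Lemma normr_normal_fun_le (R : realType) (s x : R) : s != 0 ->
  `|x| * normal_fun 0 s x <= 2 * `|s| * normal_fun 0 (2 * s) x.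
Proof.
move=> s0; rewrite /normal_fun subr0.
have s2 : 0 < s ^+ 2 by rewrite exprn_even_gt0.
pose t := 3 / 8 * (x ^+ 2 / s ^+ 2).
have -> : - x ^+ 2 / ((2 * s) ^+ 2 *+ 2) = - x ^+ 2 / (s ^+ 2 *+ 2) + t.
  by rewrite /t; field.
rewrite expRD mulrCA mulrC ler_wpM2l ?expR_ge0//.
apply: le_trans (_ : 2 * `|s| * (1 + t) <= _); last first.
  by rewrite ler_wpM2l ?expR_ge1Dx// mulr_ge0.
have as0 : 0 < `|s| by rewrite normr_gt0.
(* After multiplication by [|s|] the claim is |x| |s| <= 2 |s|^2 + 3/4 |x|^2, which follows from
   (|x| - |s|)^2 >= 0. *)
rewrite -(ler_pM2r as0).
have -> : 2 * `|s| * (1 + t) * `|s| = 2 * `|s| ^+ 2 + 3 / 4 * `|x| ^+ 2.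
  rewrite /t -(real_normK (num_real s)) -(real_normK (num_real x)).
  by field; rewrite gt_eqF.
have := sqr_ge0 (`|x| - `|s|); have := sqr_ge0 `|x|; have := sqr_ge0 `|s|.
nra.
Qed.

Lemma integrable_mul_normal_pdf (R : realType) (s : R) : s != 0 ->
  (@lebesgue_measure R).-integrable setT
    (fun x => (x * normal_pdf 0 s x)%:E).
Proof.
move=> s0.
have s20 : 2 * s != 0 by rewrite mulf_neq0.
(* [k] combines the constant of [normr_normal_fun_le] with the ratio of the two normalising
   factors. *)
pose k := 2 * `|s| * normal_peak s / normal_peak (2 * s).
have pdf_le (x : R) : `|x * normal_pdf 0 s x| <= k * normal_pdf 0 (2 * s) x.
  rewrite normrM (ger0_norm (normal_pdf_ge0 _ _ _)) !normal_pdfE// mulrCA.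
  rewrite [leRHS](_ : _ =
    normal_peak s * (2 * `|s| * normal_fun 0 (2 * s) x)).
    by rewrite ler_wpM2l ?normal_peak_ge0// normr_normal_fun_le.
  by rewrite /k; field; rewrite gt_eqF// normal_peak_gt0.
apply: (@le_integrable _ _ _ lebesgue_measure setT measurableT _
  (fun x => k%:E * (normal_pdf 0 (2 * s) x)%:E)%E).
- by apply/measurable_EFinP/measurable_funM => //; exact: measurable_normal_pdf.
- move=> x _; rewrite -EFinM !abse_EFin lee_fin.
  exact: le_trans (pdf_le x) (ler_norm _).
- exact/integrableZl/integrable_normal_pdf.
Qed.

(** The Radon-Nikodym derivative of [normal_prob] agrees almost everywhere with [normal_pdf], as
    both have the same integral over every measurable set. *)
Lemma ge0_integral_normal_prob (R : realType) (m s : R) (f : R -> \bar R) :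
  measurable_fun setT f -> (forall x, (0 <= f x)%E) ->
  (\int[normal_prob m s]_x f x =
   \int[lebesgue_measure]_x (f x * (normal_pdf m s x)%:E))%E.
Proof.
move=> mf f0; have dom := @normal_prob_dominates R m s.
rewrite -(Radon_Nikodym_SigmaFinite.change_of_variables dom)//.
apply: ae_eq_integral => //.
- apply: emeasurable_funM => //.
  apply: (measurable_int lebesgue_measure).
  exact: Radon_Nikodym_SigmaFinite.f_integrable.
- apply: emeasurable_funM => //; apply/measurable_EFinP.
  exact: measurable_normal_pdf.
- apply: ae_eqe_mul2l; apply: integral_ae_eq => //.
  + exact: Radon_Nikodym_SigmaFinite.f_integrable.
  + by apply/measurable_EFinP; exact: measurable_normal_pdf.
  + by move=> A _ mA; rewrite -Radon_Nikodym_SigmaFinite.f_integral.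
Qed.

(** Pushing forward to the law of [X] turns E|X| into the Lebesgue integral of
    [|x| * normal_pdf 0 s x], which is finite. *)
Lemma integrable_normal_rv (d : measure_display) (Om : measurableType d)
    (R : realType) (P : probability Om R) (s : R) (X : {RV P >-> R}) :
  s != 0 ->
  (forall A, measurable A -> distribution P X A = normal_prob 0 s A) ->
  P.-integrable setT (EFin \o X).
Proof.
move=> s0 PX; apply/integrableP; split; first exact/measurable_EFinP.
have /integrableP[_] := @integrable_mul_normal_pdf R s s0.
under eq_integral.
  move=> x _; rewrite abse_EFin normrM (ger0_norm (normal_pdf_ge0 _ _ _)) EFinM.
  over.
have mabs : measurable_fun [set: R] (fun x => `|x|%:E).
  by apply/measurable_EFinP; exact: normr_measurable.
rewrite -(ge0_integral_normal_prob _ _ _ (fun x => `|x|%:E))//.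
(* [normal_prob] is integrated over [measurableTypeR R], whose display is not the
   canonical one of [R], so [integral_distribution] does not apply directly. *)
pose Y : Om -> measurableTypeR R := X.
have mY : measurable_fun setT Y
  by move=> mT A mA; exact: (@measurable_funP _ _ _ _ _ X mT A mA).
rewrite (@eq_measure_integral _ _ _ _ (pushforward P Y)).
  by rewrite ge0_integral_pushforward.
by move=> A mA _; apply/esym; exact: PX.
Qed.

(** * Expectations of 1-Lipschitz functions of an affine shock *)

Section lipschitz_expectation.
Context {d : measure_display} {Om : measurableType d} {R : realType}.
Context {P : probability Om R} {Z : Om -> R} {f : R -> R}.
Hypothesis Zint : P.-integrable setT (EFin \o Z).
Hypothesis f_lip : forall x y, `|f x - f y| <= `|x - y|.

Lemma lipschitz_measurable : measurable_fun setT f.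
Proof.
apply: continuous_measurable_fun => x.
apply/cvgrPdist_le => e e0; near=> y.
apply: le_trans (f_lip _ _) _; near: y.
exact: cvgr_dist_le.
Unshelve. all: by end_near. Qed.

(** Domination: |f (c + r Z)| <= |f 0| + |c + r Z|. *)
Lemma integrable_lipschitz_comp (c r : R) :
  P.-integrable setT (fun w => (f (c + r * Z w))%:E).
Proof.
have cst_int (k : R) : P.-integrable setT (EFin \o cst k).
  exact: finite_measure_integrable_cst.
have [/measurable_EFinP mZ _] := integrableP _ _ _ Zint.
have ZI : P.-integrable setT (fun w => `|(c + r * Z w)%:E|)%E.
  apply: integrable_abse.
  exact: (integrableD measurableT (cst_int c) (integrableZl measurableT r Zint)).
apply: (le_integrable measurableT _ _
  (integrableD measurableT (cst_int `|f 0|) ZI)).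
- apply/measurable_EFinP/measurableT_comp; first exact: lipschitz_measurable.
  by apply: measurable_funD => //; exact: measurable_funM.
- move=> w _; rewrite /= lee_fin [leRHS]ger0_norm ?addr_ge0//.
  have := f_lip (c + r * Z w) 0; rewrite subr0.
  have := ler_normD (f (c + r * Z w) - f 0) (f 0).
  by rewrite subrK; lra.
Qed.

(** Both expectations share the same [Z], so the integrands differ by at most |c - c'| at every
    point, and [P] has mass 1. *)
Lemma lipschitz_expectation_le (c c' r : R) :
  `|fine 'E_P[fun w => f (c + r * Z w)] - fine 'E_P[fun w => f (c' + r * Z w)]|
  <= `|c - c'|.
Proof.
have I k := integrable_lipschitz_comp k r.
rewrite unlock -!/(Rintegral _ _ _) -RintegralB//; last 2 first.
- exact: I.
- exact: I.
apply: le_trans (le_normr_Rintegral _ _) _ => //.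
  exact: (integrableB measurableT (I c) (I c')).
rewrite [leRHS](_ : _ = (\int[P]_(w in setT) `|c - c'|)%R); last first.
  by rewrite Rintegral_cst// [X in fine X]probability_setT mulr1.
apply: le_Rintegral => //.
- exact: (integrable_abse (integrableB measurableT (I c) (I c'))).
- exact: finite_measure_integrable_cst.
- by move=> w _; apply: le_trans (f_lip _ _) _; rewrite opprD addrACA subrr addr0.
Qed.

Lemma lipschitz_expectationZ (k c r : R) :
  fine 'E_P[fun w => k * f (c + r * Z w)] =
  k * fine 'E_P[fun w => f (c + r * Z w)].
Proof.
by rewrite unlock -!/(Rintegral _ _ _) RintegralZl//;
  exact: integrable_lipschitz_comp.
Qed.

End lipschitz_expectation.

(** Carries a scaling of solution sets over to thresholds, which are defined by [get]. *)
Lemma get_scale {R : realType} {C : R} {A B : set R} : C != 0 ->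
  (forall b, A b <-> B (C * b)) -> is_subset1 A -> get B = C * get A.
Proof.
move=> C0 AB A1.
have [[a Aa]|A0] := pselect (exists a, A a).
  rewrite (get_unique Aa)//; last by move=> y Ay; exact: A1.
  apply: get_unique; first exact/AB.
  move=> y By; rewrite (A1 a (C^-1 * y)) ?mulVKf//.
  by apply/AB; rewrite mulVKf.
(* With [A] empty, [B] is empty too; both [get] return the default point of [R], which is 0, and C *
   0 = 0. *)
rewrite !xgetPN ?mulr0//.
- by move=> a Aa; apply: A0; exists a.
- by move=> b Bb; apply: A0; exists (C^-1 * b); apply/AB; rewrite mulVKf.
Qed.

Lemma minr_lipschitz {R : realDomainType} {a b a' b' e : R} :
  `|a - a'| <= e -> `|b - b'| <= e -> `|Num.min a b - Num.min a' b'| <= e.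
Proof.
rewrite !ler_norml => /andP[? ?] /andP[? ?].
by case: (leP a b) => ?; case: (leP a' b') => ?; apply/andP; split; lra.
Qed.

(** * Lipschitz bounds for the value function, uniqueness of the threshold *)

Section purchasing.
Context {d : measure_display} {Om : measurableType d} {R : realType}.
Context {P : probability Om R} {eps : nat -> {RV P >-> R}}.
Context {theta K dt : R} {N : nat}.
Hypotheses (hdt : 0 < dt) (hK : `|1 - K * dt| < 1).
Hypothesis heps : iid_shocks dt N eps.

Lemma integrable_shock i : (0 < i <= N)%N ->
  P.-integrable setT (EFin \o eps i).
Proof.
move=> iN; apply: (@integrable_normal_rv _ _ _ _ (Num.sqrt dt)).
  by rewrite gt_eqF// sqrtr_gt0.
exact: heps.2.
Qed.

(** The price enters the next one through (1 - K dt) x, so by induction the continuation term is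
    1-Lipschitz; so is the purchase term, hence their minimum. *)
Lemma value_to_go_lipschitz sigma h m x y : (m <= N)%N ->
  `|value_to_go eps theta K dt N sigma h m x -
    value_to_go eps theta K dt N sigma h m y| <= `|x - y|.
Proof.
elim: m x y => [//|m IH] x y mN /=.
apply: minr_lipschitz; last by rewrite opprD addrACA subrr addr0.
apply: le_trans (lipschitz_expectation_le _ _ _ _ _) _.
(* The shock used has index (N - m.+1).+1 = N - m, which lies between 1 and N. *)
- by apply: integrable_shock; rewrite ltn0Sn subnSK// leq_subr.
- by move=> *; apply: IH; exact: ltnW.
- rewrite opprD addrACA subrr add0r -mulrBr normrM.
  by rewrite ler_piMl// ltW.
Qed.

Lemma value_lipschitz sigma h n x y :
  `|value eps theta K dt N sigma h n x - value eps theta K dt N sigma h n y|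
  <= `|x - y|.
Proof. exact/value_to_go_lipschitz/leq_subr. Qed.

Lemma continuation_value_contraction sigma h n x y : (n < N)%N ->
  `|continuation_value eps theta K dt N sigma h n x -
    continuation_value eps theta K dt N sigma h n y|
  <= `|1 - K * dt| * `|x - y|.
Proof.
move=> nN; apply: le_trans (lipschitz_expectation_le _ _ _ _ _) _.
- exact: integrable_shock.
- exact: value_lipschitz.
- by rewrite opprD addrACA subrr add0r -mulrBr normrM.
Qed.

(** Two solutions satisfy |a - b| <= |1 - K dt| |a - b|, which forces a = b. *)
Lemma threshold_unique sigma h n : (n < N)%N ->
  is_subset1 [set b : R | continuation_value eps theta K dt N sigma h n b =
                   b + holding_cost dt N h n].
Proof.
move=> nN a b /= Ea Eb.
have := continuation_value_contraction sigma h n a b nN.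
rewrite Ea Eb opprD addrACA subrr addr0 => le_ab.
apply/eqP; rewrite -subr_eq0 -normr_le0; rewrite leNgt; apply/negP => ab0.
move: le_ab; apply/negP; rewrite -ltNge.
by rewrite gtr_pMl.
Qed.

End purchasing.

(** * Scaling of price, volatility and costs by [C] *)

Section scaling.
Context {d : measure_display} {Om : measurableType d} {R : realType}.
Context {P : probability Om R} {eps : nat -> {RV P >-> R}}.
Context {K dt : R} {N : nat}.
Hypotheses (hdt : 0 < dt) (hK : `|1 - K * dt| < 1).
Hypothesis heps : iid_shocks dt N eps.
Context {C sigma : R} {h h' : nat -> R} {n : nat}.
Hypothesis C0 : 0 < C.
Hypothesis hC : forall i, (n <= i < N)%N -> h' i = C * h i.

Lemma holding_cost_scale i : (n <= i)%N ->
  holding_cost dt N h' i = C * holding_cost dt N h i.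
Proof.
move=> ni; rewrite /holding_cost mulrCA; congr (_ * _).
rewrite mulr_sumr; apply: eq_big_nat => j /andP[ij jN].
by rewrite hC// jN (leq_trans ni).
Qed.

(** Scaling at the next date is a premise, so that the lemma serves both the induction step of
    [value_scale] and the threshold equation. *)
Lemma continuation_value_scale i x : (i < N)%N ->
  (forall y, value eps 0 K dt N (C * sigma) h' i.+1 (C * y) =
             C * value eps 0 K dt N sigma h i.+1 y) ->
  continuation_value eps 0 K dt N (C * sigma) h' i (C * x) =
  C * continuation_value eps 0 K dt N sigma h i x.
Proof.
move=> iN IH; rewrite /continuation_value /next_price.
rewrite -lipschitz_expectationZ.
- congr (fine _); congr expectation; apply/funext => w.
  (* As theta is 0, the next price from C x under volatility C sigma is C times the one from x under
     sigma. *)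
  by rewrite -IH; congr value; ring.
- exact: (integrable_shock hdt heps i.+1).
- exact: (value_lipschitz hdt hK heps sigma h i.+1).
Qed.

Lemma value_scale i x : (n <= i <= N)%N ->
  value eps 0 K dt N (C * sigma) h' i (C * x) =
  C * value eps 0 K dt N sigma h i x.
Proof.
(* Writing i as N - (N - i) allows induction on the number of remaining periods. *)
case/andP=> + iN; rewrite -(subKn iN).
elim: (N - i)%N (leq_subr i N) x => [|m IH] mN x ni.
  by rewrite subn0 !value_horizon.
have iltN : (N - m.+1 < N)%N by rewrite ltn_subrL/= (leq_ltn_trans _ mN).
rewrite !value_before_horizon// holding_cost_scale// continuation_value_scale//.
  by rewrite -mulrDr minr_pMr// ltW.
by move=> y; rewrite subnSK// IH ?(ltnW mN)// (leq_trans ni)// leq_sub2l.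
Qed.

Lemma threshold_scale : (n < N)%N ->
  threshold eps 0 K dt N (C * sigma) h' n =
  C * threshold eps 0 K dt N sigma h n.
Proof.
move=> nN; apply: get_scale.
- by rewrite gt_eqF.
- move=> b /=; rewrite holding_cost_scale// continuation_value_scale//.
    rewrite -mulrDr; split=> [-> //|]; apply: mulfI.
    by rewrite gt_eqF.
  by move=> y; apply: value_scale; rewrite leqnSn.
- exact: threshold_unique.
Qed.

End scaling.

Theorem lemma6 (d : measure_display) (Om : measurableType d) (R : realType)
    (P : probability Om R) (eps : nat -> {RV P >-> R})
    (theta K dt : R) (N : nat) (h : nat -> R -> R) (n : nat)
    (hdt : 0 < dt) (hK : `|1 - K * dt| < 1)
    (heps : iid_shocks dt N eps)
    (hdecr : forall s : R, 0 < s ->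
       forall i j, (i <= j)%N -> (j < N)%N -> h j s <= h i s)
    (htheta : theta = 0) (hn : (n < N)%N)
    (hlin : forall i, (n <= i < N)%N ->
       forall C s0 : R, 0 < C -> 0 < s0 -> h i (C * s0) = C * h i s0) :
  forall C s0 : R, 0 < C -> 0 < s0 ->
    threshold eps theta K dt N (C * s0) (fun i => h i (C * s0)) n =
    C * threshold eps theta K dt N s0 (fun i => h i s0) n.
Proof.
move=> C s0 C0 s00; rewrite htheta; apply: threshold_scale => // i ni.
exact: hlin.
Qed.
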